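(* Let $n\ge 2$ be an integer and let $L_n=\langle a,t \mid a^n,\ [t^{i}at^{-i},t^{j}at^{-j}]\ (i,j\in\mathbb{Z})\rangle$ be the lamplighter group. Then $L_n$ contains dead end words of arbitrary depth with respect to the generating set $\{a,t\}$; that is, for every positive integer $k$ there is an element of $L_n$ which is a dead end word with respect to $\{a,t\}$ of depth at least $k$.
   Context: For a group $G$ with finite generating set $X$, $|w|$ denotes the word length of $w\in G$ with respect to $X$ (the least number of letters from $X\cup X^{-1}$ in a product equal to $w$). An element $w\in G$ with $|w|=N$ is a dead end word with respect to $X$ if $|wx|\le N$ for all $x\in X\cup X^{-1}$. A dead end word $w$ with $|w|=N$ has depth $k$ with respect to $X$ if $k$ is the largest integer such that $|wx_1x_2\cdots x_l|\le N$ for all $1\le l\le k$ and all choices of $x_1,\dots,x_l\in X\cup X^{-1}$. In particular, $w$ has depth at least $k$ if this inequality holds for all $1\le l\le k$ and all such choices. *)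

(* Defs.v *)
From HB Require Import structures.
From mathcomp Require Import all_boot all_order all_algebra.
From mathcomp Require Import monoid generic_quotient.
From mathcomp.classical Require Import boolp.

Set Implicit Arguments.
Unset Strict Implicit.
Unset Printing Implicit Defensive.

Local Open Scope quotient_scope.
Local Open Scope group_scope.

Section Words.

Variable X : choiceType.

(* [(x, true)] stands for the letter x and [(x, false)] for its inverse. *)
Definition fword := seq (X * bool).

Implicit Types (u v w : fword).

Definition fgen (x : X) : fword := [:: (x, true)].

Definition finv w : fword := rev [seq (l.1, ~~ l.2) | l <- w].

Definition fexp w (m : nat) : fword := flatten (nseq m w).

Definition fexpz w (i : int) : fword :=
  match i with Posz m => fexp w m | Negz m => fexp (finv w) m.+1 end.

Definition fcomm u v : fword := u ++ v ++ finv u ++ finv v.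

Variable rel : fword -> Prop.

(* The least monoid congruence on words that cancels adjacent inverse letters
   and kills the relators: its quotient is the free group modulo the normal
   closure of the relators. *)
Inductive pres_cong : fword -> fword -> Prop :=
| PresRefl u : pres_cong u u
| PresSym u v : pres_cong u v -> pres_cong v u
| PresTrans u v w : pres_cong u v -> pres_cong v w -> pres_cong u w
| PresCat u u' v v' :
    pres_cong u u' -> pres_cong v v' -> pres_cong (u ++ v) (u' ++ v')
| PresCancel x b : pres_cong [:: (x, b); (x, ~~ b)] [::]
| PresRel r : rel r -> pres_cong r [::].

Definition pres_congb u v : bool := `[< pres_cong u v >].

Lemma pres_congb_refl : reflexive pres_congb.
Proof. by move=> u; apply/asboolP; exact: PresRefl. Qed.

Lemma pres_congb_sym : symmetric pres_congb.
Proof. by move=> u v; apply/asboolP/asboolP; exact: PresSym. Qed.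

Lemma pres_congb_trans : transitive pres_congb.
Proof.
move=> v u w /asboolP uv /asboolP vw; apply/asboolP; exact: PresTrans uv vw.
Qed.

Canonical pres_equiv :=
  EquivRel pres_congb pres_congb_refl pres_congb_sym pres_congb_trans.

Definition presented := {eq_quot pres_equiv}.

HB.instance Definition _ := Choice.on presented.
HB.instance Definition _ := Quotient.on presented.
HB.instance Definition _ := EqQuotient.on presented.

Definition pres_class w : presented := \pi_presented w.

Lemma pres_classP u v : pres_class u = pres_class v <-> pres_cong u v.
Proof.
split; first by move/eqmodP => /asboolP.
by move=> uv; apply/eqmodP; apply/asboolP.
Qed.

Lemma repr_pres_class w : pres_cong (repr (pres_class w)) w.
Proof. by apply/pres_classP; rewrite /pres_class reprK. Qed.

Lemma finv_cat u v : finv (u ++ v) = finv v ++ finv u.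
Proof. by rewrite /finv map_cat rev_cat. Qed.

Lemma finvK : involutive finv.
Proof.
move=> u; rewrite /finv map_rev revK -map_comp map_id_in // => -[x b] _ /=.
by rewrite negbK.
Qed.

Lemma pres_cong_catV u : pres_cong (u ++ finv u) [::].
Proof.
elim/last_ind: u => [|u [x b] IHu]; first exact: PresRefl.
rewrite -cats1 finv_cat catA -(catA u); apply: (PresTrans _ IHu).
apply: (PresCat _ (PresRefl _)); rewrite -[X in pres_cong _ X]cats0.
exact: PresCat (PresRefl u) (PresCancel x b).
Qed.

Lemma pres_cong_catVl u : pres_cong (finv u ++ u) [::].
Proof. by rewrite -{2}[u]finvK; exact: pres_cong_catV. Qed.

Lemma pres_cong_inv u v : pres_cong u v -> pres_cong (finv u) (finv v).
Proof.
move=> uv; rewrite -[finv u]cats0.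
apply: PresTrans (PresCat (PresRefl _) (PresSym (pres_cong_catV v))) _.
rewrite catA -[X in pres_cong _ X]cat0s; apply: (PresCat _ (PresRefl _)).
apply: PresTrans (pres_cong_catVl u).
exact: PresCat (PresRefl _) (PresSym uv).
Qed.

Definition pres_one : presented := pres_class [::].
Definition pres_mul (g h : presented) : presented :=
  pres_class (repr g ++ repr h).
Definition pres_inv (g : presented) : presented := pres_class (finv (repr g)).

Lemma pres_class_cat u v :
  pres_mul (pres_class u) (pres_class v) = pres_class (u ++ v).
Proof. by apply/pres_classP; apply: PresCat; exact: repr_pres_class. Qed.

Lemma pres_class_inv u : pres_inv (pres_class u) = pres_class (finv u).
Proof. by apply/pres_classP; apply: pres_cong_inv; exact: repr_pres_class. Qed.

Lemma presentedP (g : presented) : exists u, g = pres_class u.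
Proof. by exists (repr g); rewrite /pres_class reprK. Qed.

Lemma pres_mulA : associative pres_mul.
Proof.
move=> g h k; have [u ->] := presentedP g; have [v ->] := presentedP h.
by have [w ->] := presentedP k; rewrite !pres_class_cat catA.
Qed.

Lemma pres_1mul : left_id pres_one pres_mul.
Proof. by move=> g; have [u ->] := presentedP g; rewrite pres_class_cat. Qed.

Lemma pres_mul1 : right_id pres_one pres_mul.
Proof.
by move=> g; have [u ->] := presentedP g; rewrite pres_class_cat cats0.
Qed.

Lemma pres_Vmul : left_inverse pres_one pres_inv pres_mul.
Proof.
move=> g; have [u ->] := presentedP g; rewrite pres_class_inv pres_class_cat.
by apply/pres_classP; exact: pres_cong_catVl.
Qed.

Lemma pres_mulV : right_inverse pres_one pres_inv pres_mul.
Proof.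
move=> g; have [u ->] := presentedP g; rewrite pres_class_inv pres_class_cat.
by apply/pres_classP; exact: pres_cong_catV.
Qed.

HB.instance Definition _ :=
  isGroup.Build presented pres_mulA pres_1mul pres_mul1 pres_Vmul pres_mulV.

Lemma pres_classM u v : pres_class (u ++ v) = pres_class u * pres_class v.
Proof. by rewrite -pres_class_cat. Qed.

Lemma pres_classV u : pres_class (finv u) = (pres_class u)^-1.
Proof. by rewrite -pres_class_inv. Qed.

End Words.

Section WordLength.

Variables (G : groupType) (X : seq G).

Definition letter (x : G) : bool := (x \in X) || (x^-1 \in X).

Definition is_product (w : G) (N : nat) : Prop :=
  exists s : seq G, [/\ size s = N, all letter s & w = \prod_(x <- s) x].

Definition generates : Prop := forall w, exists N, `[< is_product w N >].

Variable genX : generates.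

Definition word_length (w : G) : nat := ex_minn (genX w).

Definition dead_end (w : G) : Prop :=
  forall x, letter x -> (word_length (w * x) <= word_length w)%N.

Definition depth_at_least (k : nat) (w : G) : Prop :=
  forall s : seq G, (1 <= size s <= k)%N -> all letter s ->
    (word_length (w * \prod_(x <- s) x) <= word_length w)%N.

End WordLength.

Section Lamplighter.

Variable n : nat.

(* The two generators: [true] is a and [false] is t. *)
Definition wa : fword bool := fgen true.
Definition wt : fword bool := fgen false.

Definition conj_a (i : int) : fword bool :=
  fexpz wt i ++ wa ++ fexpz wt (- i)%R.

Definition lamp_rel (r : fword bool) : Prop :=
  r = fexp wa n \/ exists i j : int, r = fcomm (conj_a i) (conj_a j).

Definition lamplighter : groupType := presented lamp_rel.

Definition lamp_a : lamplighter := pres_class lamp_rel wa.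
Definition lamp_t : lamplighter := pres_class lamp_rel wt.

Lemma lamp_generates : generates [:: lamp_a; lamp_t].
Proof.
move=> g; have [u ->] := presentedP g.
elim: u => [|[x b] u [N /asboolP[s [sN sX gs]]]].
  by exists 0%N; apply/asboolP; exists [::]; rewrite big_nil.
exists N.+1; apply/asboolP; exists (pres_class lamp_rel [:: (x, b)] :: s).
split; [by rewrite /= sN | | by rewrite big_cons -cat1s pres_classM gs].
rewrite /= sX andbT /letter !inE.
by case: b; rewrite -?pres_classV; case: x; rewrite eqxx ?orbT.
Qed.

End Lamplighter.

Arguments lamp_generates n : clear implicits.

(* Main.v *)
Require Import Defs.
From mathcomp Require Import all_boot.
From mathcomp Require Import all_order all_algebra monoid zify.
From mathcomp.classical Require Import boolp.

Set Implicit Arguments.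
Unset Strict Implicit.
Unset Printing Implicit Defensive.

Import GRing.Theory.

(** An element of the lamplighter group is a finitely supported configuration
    of n-state lamps on the integers together with a position of the
    lamplighter: the letters a and a^-1 change the lamp at the current position
    by one, t and t^-1 move one step.  Let h = n./2 and m = k, and let w have
    every lamp of the window [-m, m] in state h and the lamplighter back at 0.
    Two bounds on lengths make w a dead end of depth at least m.

    Upper bound ([word_length_placed]).  Suppose that only lamps of [-m, m] are
    lit and that the lamplighter stands at q in [-m, m].  Each lamp costs at
    most h letters, and a walk that starts at 0, goes to the end of the window
    opposite to q, sweeps to the other end and comes back to q has 4m - |q|
    steps.  So the length is at most (2m + 1)h + 4m.

    Lower bound ([le_word_length_placed]).  State h is at distance h from 0
    modulo n, so lighting the lamps of w takes (2m + 1)h letters a or a^-1; and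
    a closed walk at 0 that visits both m and -m has at least 4m steps.  So w
    attains the upper bound.

    Multiplying w by at most m letters keeps lamps and lamplighter in the
    window ([placed_ball]), hence does not increase the length.

    The upper bound is proved inside the group from the defining relations.
    The lower bound uses the action of the group on configurations, which
    exists because the relators act trivially ([wact_cong]), and an invariant
    of walks ([toured]).  The hypothesis on n enters as h <> 0: the outermost
    lamps of w are lit, which is what forces the visits to m and -m. *)

Local Open Scope group_scope.

(** * Word length in a finitely generated group *)

Lemma conjugate_expg (G : groupType) (x y : G) m :
  x * y ^+ m * x^-1 = (x * y * x^-1) ^+ m.
Proof. by have := conjXg y x^-1 m; rewrite !conjgE invgK !mulgA. Qed.

Section WordLengthTheory.

Variables (G : groupType) (X : seq G) (genX : generates X).
Local Notation wl := (word_length genX).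

Lemma is_product_word_length g : is_product X g (wl g).
Proof. by rewrite /word_length; case: ex_minnP => m /asboolP. Qed.

Lemma word_length_prod s : all (letter X) s -> wl (\prod_(x <- s) x) <= size s.
Proof.
move=> sX; rewrite /word_length; case: ex_minnP => m _; apply.
by apply/asboolP; exists s.
Qed.

Lemma word_length1 : wl 1 = 0.
Proof.
apply/eqP; rewrite -leqn0.
by have := @word_length_prod [::] isT; rewrite big_nil.
Qed.

Lemma word_length_letter x : letter X x -> wl x <= 1.
Proof.
move=> xX; have /word_length_prod : all (letter X) [:: x] by rewrite /= xX.
by rewrite big_seq1.
Qed.

Lemma letterV x : letter X x -> letter X x^-1.
Proof. by rewrite /letter invgK orbC. Qed.

Lemma word_lengthM g h : wl (g * h) <= wl g + wl h.
Proof.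
have [s [<- sX ->]] := is_product_word_length g.
have [r [<- rX ->]] := is_product_word_length h.
by rewrite -big_cat -size_cat word_length_prod // all_cat sX.
Qed.

Lemma word_lengthX x i : letter X x -> wl (x ^+ i) <= i.
Proof.
move=> xX; elim: i => [|i IHi]; first by rewrite expg0 word_length1.
rewrite expgS -add1n (leq_trans (word_lengthM _ _)) // leq_add //.
exact: word_length_letter.
Qed.

End WordLengthTheory.

(** * The action of the group on lamp configurations *)

Section Lamplighter.

(* There are at least two lamp states, so that the ordinals below n form the
   ring of integers modulo n. *)
Variable n' : nat.
Local Notation n := n'.+2.

Definition config := ((int -> 'I_n) * int)%type.

Definition toggle (c : 'I_n) (p : int) (f : int -> 'I_n) : int -> 'I_n :=
  fun i => (f i + c *+ (i == p))%R.

Lemma toggleC c p d q f : toggle c p (toggle d q f) = toggle d q (toggle c p f).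
Proof. by apply/funext => i; rewrite /toggle addrAC. Qed.

Lemma toggleD c d p f : toggle c p (toggle d p f) = toggle (d + c)%R p f.
Proof. by apply/funext => i; rewrite /toggle mulrnDl addrA. Qed.

Lemma toggle0 p f : toggle 0%R p f = f.
Proof. by apply/funext => i; rewrite /toggle mul0rn addr0. Qed.

Definition move_letter (s : config) (l : bool * bool) : config :=
  let e : int := if l.2 then 1%R else (-1)%R in
  if l.1 then (toggle (e%:~R)%R s.2 s.1, s.2) else (s.1, s.2 + e)%R.

(** Words are read from left to right, so this becomes a right action: the
    lamplighter executes the letters in the order in which they are written. *)
Definition wact (u : fword bool) (s : config) : config := foldl move_letter s u.

Lemma wact_cat u v s : wact (u ++ v) s = wact v (wact u s).
Proof. exact: foldl_cat. Qed.

Lemma move_letterK x b s : move_letter (move_letter s (x, b)) (x, ~~ b) = s.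
Proof.
case: s => f p; case: x => /=; rewrite /move_letter /=.
  by rewrite toggleD -intrD; case: b => /=; rewrite ?addrN ?addNr toggle0.
by congr (_, _); case: b => /=; lia.
Qed.

Lemma wact_finv u s : wact (Defs.finv u) (wact u s) = s.
Proof.
elim: u s => [//|[x b] u IHu] s.
rewrite -cat1s finv_cat !wact_cat IHu; exact: move_letterK.
Qed.

Lemma wact_wt (i : int) f p : wact (fexpz wt i) (f, p) = (f, p + i)%R.
Proof.
case: i => m; rewrite /fexpz /fexp.
  elim: m p => [|m IHm] p /=; first by rewrite addr0.
  by rewrite IHm; congr (_, _) => /=; lia.
rewrite NegzE; elim: m.+1 p => [|j IHj] p /=; first by rewrite oppr0 addr0.
by rewrite IHj; congr (_, _) => /=; lia.
Qed.

Lemma wact_conj_a i f p : wact (conj_a i) (f, p) = (toggle 1%R (p + i)%R f, p).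
Proof.
rewrite /conj_a wact_cat wact_wt wact_cat /= /move_letter /= wact_wt.
by congr (_, _); lia.
Qed.

Lemma wact_wa m f p : wact (fexp wa m) (f, p) = (toggle (m%:R)%R p f, p).
Proof.
elim: m f => [|m IHm] f /=; first by rewrite toggle0.
by rewrite IHm /move_letter /= toggleD -natr1 addrC.
Qed.

(** The relators act trivially: n increments of one lamp cancel modulo n, and
    the conjugates of a by powers of t change single lamps without moving the
    lamplighter, hence commute.  So the action descends to the group. *)
Lemma wact_cong u v : pres_cong (lamp_rel n) u v -> wact u =1 wact v.
Proof.
elim=> {u v}.
- by [].
- by move=> u v _ uv s; rewrite uv.
- by move=> u v w _ uv _ vw s; rewrite uv vw.
- by move=> u u' v v' _ uu' _ vv' s; rewrite !wact_cat uu' vv'.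
- by move=> x b s; apply: move_letterK.
- move=> _ [->|[i [j ->]]] [f p].
    by rewrite wact_wa (@pchar_Zp n) // toggle0.
  rewrite /fcomm 3!wact_cat !wact_conj_a toggleC.
  by rewrite -(wact_conj_a i) wact_finv -(wact_conj_a j) wact_finv.
Qed.

Local Notation L := (lamplighter n).
Local Notation a := (lamp_a n).
Local Notation t := (lamp_t n).
Local Notation X := [:: a; t].

Definition gact (g : L) : config -> config := wact (repr g).

Lemma gact_class u : gact (pres_class (lamp_rel n) u) =1 wact u.
Proof. by apply: wact_cong; exact: repr_pres_class. Qed.

Lemma gactM g h s : gact (g * h) s = gact h (gact g s).
Proof.
have [u ->] := presentedP g; have [v ->] := presentedP h.
by rewrite -pres_classM !gact_class wact_cat.
Qed.

Lemma gact1 s : gact 1 s = s.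
Proof. exact: (gact_class [::]). Qed.

Lemma gactVK g s : gact g^-1 (gact g s) = s.
Proof. by rewrite -gactM mulgV gact1. Qed.

Lemma gact_aX m f p : gact (a ^+ m) (f, p) = (toggle (m%:R)%R p f, p).
Proof.
elim: m f => [|m IHm] f; first by rewrite expg0 gact1 toggle0.
by rewrite expgS gactM gact_class IHm toggleD -natr1 addrC.
Qed.

Lemma gact_tX m f p : gact (t ^+ m) (f, p) = (f, p + m%:Z)%R.
Proof.
elim: m p => [|m IHm] p; first by rewrite expg0 gact1 addr0.
by rewrite expgS gactM gact_class IHm; congr (_, _) => /=; lia.
Qed.

Lemma gact_tXV m f p : gact (t ^- m) (f, p) = (f, p - m%:Z)%R.
Proof. by rewrite -{1}[p](subrK (m%:Z)%R) -gact_tX gactVK. Qed.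

Lemma lamp_letterP x :
  letter X x -> exists l, x = pres_class (lamp_rel n) [:: l].
Proof.
rewrite /letter !inE => /orP[] /orP[] /eqP.
- by move->; exists (true, true).
- by move->; exists (false, true).
- by move/(canRL (@invgK _)) ->; exists (true, false); rewrite -pres_classV.
- by move/(canRL (@invgK _)) ->; exists (false, false); rewrite -pres_classV.
Qed.

(** * Lower bound: lamps to light and steps to walk *)

(** The distance from x to 0 on a cycle of n states. *)
Definition lamp_cost (x : 'I_n) : nat := minn x (n - x).

Lemma lamp_cost0 : lamp_cost 0%R = 0.
Proof. by rewrite /lamp_cost min0n. Qed.

Lemma lamp_costN x : lamp_cost (- x)%R = lamp_cost x.
Proof.
rewrite /lamp_cost /=; have := ltn_ord x; rewrite /Zp_trunc /= => xn.
have [->|x0] := posnP x; first by rewrite subn0 modnn !min0n.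
by rewrite modn_small; lia.
Qed.

Lemma lamp_cost1 x : lamp_cost (x + 1)%R <= (lamp_cost x).+1.
Proof.
rewrite /lamp_cost /=; have := ltn_ord x; rewrite /Zp_trunc /= => xn.
rewrite (modn_small (m := 1)) //.
have [xlt|] := ltnP (x + 1) n; first by rewrite modn_small; lia.
move=> xge; have -> : (x + 1)%N = n by lia.
by rewrite modnn min0n.
Qed.

Lemma lamp_cost_sign x b :
  lamp_cost (x + (if b then 1%R else (-1)%R : int)%:~R)%R <= (lamp_cost x).+1.
Proof.
case: b; first exact: lamp_cost1.
by rewrite -lamp_costN opprD /= opprK -[lamp_cost x]lamp_costN lamp_cost1.
Qed.

Lemma lamp_cost_nat h : h.*2 <= n -> lamp_cost (h%:R)%R = h.
Proof.
move=> hn; have hE : (h%:R : 'I_n)%R = h :> nat.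
  by rewrite (@val_Zp_nat n) // modn_small //; lia.
by rewrite /lamp_cost hE; apply/minn_idPl; lia.
Qed.

Definition window_cost (m : nat) (f : int -> 'I_n) : nat :=
  \sum_(i < m.*2.+1) lamp_cost (f (i%:Z - m%:Z)%R).

Lemma window_cost_toggle m f p b :
  window_cost m (toggle (if b then 1%R else (-1)%R : int)%:~R%R p f)
    <= (window_cost m f).+1.
Proof.
(* At most one lamp of the window sits at position p. *)
have le1 N : \sum_(i < N) (i%:Z - m%:Z == p)%R <= ((p < N%:Z - m%:Z)%R : nat).
  elim: N => [|N IHN]; first by rewrite big_ord0.
  rewrite big_ord_recr /=; move: (\sum_(i < N) _) IHN => S.
  case: eqP => [Np|Np]; case: (boolP (p < N%:Z - m%:Z)%R) => pN;
    case: (boolP (p < N.+1%:Z - m%:Z)%R) => pN1 /=; lia.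
apply: (@leq_trans (window_cost m f + \sum_(i < m.*2.+1) (i%:Z - m%:Z == p)%R)).
  rewrite -big_split leq_sum // => i _; rewrite /toggle /=.
  case: eqP => _; last by rewrite addr0 leq_addr.
  by rewrite addn1 lamp_cost_sign.
have := leq_trans (le1 m.*2.+1) (leq_b1 _); lia.
Qed.

(** The potential behind the lower bound.  The extreme positions of the walk so
    far are -K and M, so all lit lamps lie between them.  A walk from 0 to p
    with these extremes has at least 2(K + M) - |p| steps, since it reaches one
    extreme, crosses to the other and goes on to p; the lamps of the window
    [-m, m] account for further letters. *)
Definition toured (m N : nat) (s : config) : Prop :=
  exists K M : nat,
    [/\ (- K%:Z <= s.2 <= M%:Z)%R,
        forall i, s.1 i != 0%R -> (- K%:Z <= i <= M%:Z)%R
      & (K + M).*2 + window_cost m s.1 <= N + `|s.2|%N].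

Lemma toured0 m : toured m 0 (fun=> 0%R, 0%R).
Proof.
by exists 0, 0; split=> //=; rewrite /window_cost big1.
Qed.

Lemma toured_move m N s l : toured m N s -> toured m N.+1 (move_letter s l).
Proof.
case: s l => f p [x b] [K [M [/= pKM fKM cost]]].
case: x; rewrite /move_letter /=.
  exists K, M; split=> //=; last first.
    have := leq_add (leqnn (K + M).*2) (window_cost_toggle m f p b).
    by move/leq_trans; apply; lia.
  move=> i; rewrite /toggle; case: (i =P p) => [->//|_].
  by rewrite addr0; exact: fKM.
(* A step that stays in [-K, M] changes |p| by one.  A step that leaves it adds
   one to K + M, but also to |p|, so the required length still grows by one. *)
case: b.
  have [pM|pM] := boolP (p == M%:Z)%R.
    by exists K, M.+1; split=> /= [|i /fKM|]; lia.
  by exists K, M; split=> /= [|i /fKM|]; lia.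
have [pK|pK] := boolP (p == - K%:Z)%R.
  by exists K.+1, M; split=> /= [|i /fKM|]; lia.
by exists K, M; split=> /= [|i /fKM|]; lia.
Qed.

Lemma toured_prod m (s : seq L) : all (letter X) s ->
  toured m (size s) (gact (\prod_(x <- s) x) (fun=> 0%R, 0%R)).
Proof.
elim/last_ind: s => [|s x IHs].
  by rewrite big_nil gact1 => _; exact: toured0.
rewrite all_rcons => /andP[/lamp_letterP[l ->] /IHs].
rewrite size_rcons -cats1 big_cat big_seq1 gactM gact_class; exact: toured_move.
Qed.

(** * Configurations as products of commuting lamps *)

Definition lit (c : nat -> nat) (i : nat) : L := t ^+ i * a ^+ c i * t ^- i.

Definition lamps (c : nat -> nat) (j : nat) : L := \prod_(i < j) lit c i.

Lemma lamp_aXn : a ^+ n = 1.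
Proof.
have wa_X m : pres_class (lamp_rel n) (fexp wa m) = a ^+ m.
  by elim: m => [//|m IHm]; rewrite expgS -IHm -pres_classM.
by rewrite -wa_X; apply/pres_classP; apply: PresRel; left.
Qed.

Lemma lamp_conj_aE i :
  pres_class (lamp_rel n) (conj_a (Posz i)) = t ^+ i * a * t ^- i.
Proof.
have wtX m : pres_class (lamp_rel n) (fexp wt m) = t ^+ m.
  by elim: m => [//|m IHm]; rewrite expgS -IHm -pres_classM.
have wtXV m : pres_class (lamp_rel n) (fexp (Defs.finv wt) m) = t^-1 ^+ m.
  elim: m => [//|m IHm].
  by rewrite expgS -IHm -pres_classV -pres_classM.
rewrite /conj_a !pres_classM wtX mulgA; congr (_ * _).
case: i => [|i]; first by rewrite expg0 invg1.
by rewrite -expVgn -wtXV.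
Qed.

Lemma lamp_conj_a_commute i j :
  commute (t ^+ i * a * t ^- i) (t ^+ j * a * t ^- j).
Proof.
have : pres_class (lamp_rel n) (fcomm (conj_a (Posz i)) (conj_a (Posz j))) = 1.
  by apply/pres_classP; apply: PresRel; right; exists (Posz i), (Posz j).
rewrite (pres_classM _ (conj_a i)) (pres_classM _ (conj_a j)).
rewrite (pres_classM _ (Defs.finv (conj_a i))) !pres_classV !lamp_conj_aE => uv1.
by apply: divg1_eq; rewrite invgM -mulgA.
Qed.

Lemma lit_commute c d i j : commute (lit c i) (lit d j).
Proof.
by rewrite /lit !conjugate_expg; apply: commuteX2; exact: lamp_conj_a_commute.
Qed.

Lemma lit_lamps_commute c d i j : commute (lit d i) (lamps c j).
Proof. by apply: commute_prod => k _; exact: lit_commute. Qed.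

(** A change of lamp q made at the end can be absorbed into the factor of
    lamp q, because it commutes with the factors of the later lamps. *)
Lemma lamps_toggle c d q j : q < j ->
  lamps (fun i => c i + d * (i == q)) j = lamps c j * (t ^+ q * a ^+ d * t ^- q).
Proof.
elim: j => // j IHj; rewrite ltnS /lamps !big_ord_recr /= leq_eqVlt.
case/orP=> [/eqP->|qj].
  rewrite -mulgA; congr (_ * _).
    by apply: eq_bigr => i _; rewrite /lit (ltn_eqF (ltn_ord i)) muln0 addn0.
  by rewrite /lit eqxx muln1 expgnDr !mulgA mulgVK.
rewrite -/(lamps c j) -/(lamps _ j) IHj // -!(mulgA (lamps c j)); congr (_ * _).
have -> : lit (fun i => c i + d * (i == q)) j = lit c j.
  by rewrite /lit (gtn_eqF qj) muln0 addn0.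
exact: (lit_commute (fun=> d) c q j).
Qed.

Variable m : nat.

(** The element with lamp i - m in state c i for i <= 2m and the lamplighter at
    p - m.  The shift by m makes all positions of the window natural numbers. *)
Definition placed (c : nat -> nat) (p : nat) : L :=
  t ^- m * lamps c m.*2.+1 * t ^+ p.

Lemma placed_aX c p d : p <= m.*2 ->
  placed c p * a ^+ d = placed (fun i => c i + d * (i == p)) p.
Proof. by move=> pm; rewrite /placed lamps_toggle // !mulgA mulgVK. Qed.

Lemma placed_letter c p x : 0 < p <= m.*2 -> letter X x ->
  exists c' p', [/\ placed c p * x = placed c' p' & p.-1 <= p' <= p.+1].
Proof.
case/andP=> p0 pm; rewrite /letter !inE => /orP[] /orP[] /eqP.
- move->; exists (fun i => c i + 1 * (i == p)), p.
  by rewrite -placed_aX // expg1; split=> //; lia.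
- by move->; exists c, p.+1; rewrite /placed expgSr mulgA; split=> //; lia.
(* As a^-1 = a^(n - 1), decrements need no negative exponents. *)
- move/(canRL (@invgK _)) ->; exists (fun i => c i + n.-1 * (i == p)), p.
  rewrite -placed_aX //; split; last by lia.
  by congr (_ * _); apply: mulg1_eq; rewrite -expgS lamp_aXn.
- move/(canRL (@invgK _)) ->; exists c, p.-1; split; last by lia.
  by rewrite /placed -{1}(prednK p0) expgSr mulgA mulgK.
Qed.

(** Each letter moves the lamplighter by at most one step, so m letters do not
    take it from the centre of the window to the outside. *)
Lemma placed_ball c (s : seq L) : all (letter X) s -> size s <= m ->
  exists c' p, placed c m * \prod_(x <- s) x = placed c' p /\
    m - size s <= p <= m + size s.
Proof.
elim/last_ind: s => [|s x IHs].
  by exists c, m; rewrite big_nil mulg1 subn0 addn0 leqnn.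
rewrite all_rcons size_rcons => /andP[xX sX] sm.
have [|c1 [p1 [cE pE]]] := IHs sX; first lia.
have [|c2 [p2 [c2E p2E]]] := @placed_letter c1 p1 x _ xX; first lia.
exists c2, p2; split; last lia.
by rewrite -cats1 big_cat big_seq1 mulgA cE.
Qed.

(** * Upper bound: sweeping the window *)

Local Notation wl := (word_length (lamp_generates n)).

Lemma letter_a : letter X a. Proof. by rewrite /letter !inE eqxx. Qed.
Lemma letter_t : letter X t. Proof. by rewrite /letter !inE eqxx orbT. Qed.

(** Modulo n, a lamp is set by whichever is shorter of increments and
    decrements. *)
Lemma word_length_aX d : wl (a ^+ d) <= n./2.
Proof.
have red : a ^+ d = a ^+ (d %% n).
  by rewrite {1}(divn_eq d n) expgnDr mulnC expgnA lamp_aXn expg1n mul1g.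
have dn := ltn_pmod d (isT : 0 < n); rewrite red.
have [dh|dh] := leqP (d %% n) n./2.
  exact: leq_trans (word_lengthX _ _ letter_a) dh.
have -> : a ^+ (d %% n) = a^-1 ^+ (n - d %% n).
  rewrite expVgn; apply/esym/mulg1_eq.
  by rewrite -expgnDr subnK ?lamp_aXn // ltnW.
apply: leq_trans (word_lengthX _ _ (letterV letter_a)) _.
by have := odd_double_half n; lia.
Qed.

Lemma word_length_tX i : wl (t ^+ i) <= i.
Proof. exact: word_lengthX letter_t. Qed.

Lemma word_length_tXV i : wl (t ^- i) <= i.
Proof. by rewrite -expVgn; apply: word_lengthX (letterV letter_t). Qed.

(** The product of lamps in increasing order telescopes to
    a^(c 0) t a^(c 1) t ... t a^(c j), a single pass from 0 to j. *)
Lemma sweep_up c j : wl (lamps c j.+1 * t ^+ j) <= j.+1 * n./2 + j.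
Proof.
elim: j => [|j IHj].
  rewrite /lamps big_ord_recr big_ord0 /lit /= expg0 invg1 !(mulg1, mul1g).
  by rewrite mul1n addn0 word_length_aX.
have -> : lamps c j.+2 * t ^+ j.+1 = lamps c j.+1 * t ^+ j * (t * a ^+ c j.+1).
  by rewrite /lamps big_ord_recr /= /lit !mulgA mulgVK -(mulgA _ _ t) -expgSr.
apply: leq_trans (word_lengthM _ _ _) _.
apply: leq_trans (leq_add IHj (word_lengthM _ _ _)) _.
have := word_length_aX (c j.+1); have := word_length_tX 1; rewrite expg1.
by rewrite (mulSn j.+1); lia.
Qed.

(** Since the lamps commute, they can also be lit in decreasing order, in a
    single pass from j to 0: a^(c j) t^-1 a^(c (j - 1)) t^-1 ... t^-1 a^(c 0). *)
Lemma sweep_down c j : wl (t ^- j * lamps c j.+1) <= j.+1 * n./2 + j.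
Proof.
elim: j => [|j IHj].
  rewrite /lamps big_ord_recr big_ord0 /lit /= expg0 invg1 !(mulg1, mul1g).
  by rewrite mul1n addn0 word_length_aX.
have -> : t ^- j.+1 * lamps c j.+2 =
    a ^+ c j.+1 * t^-1 * (t ^- j * lamps c j.+1).
  rewrite /lamps big_ord_recr /= -/(lamps c j.+1) -(lit_lamps_commute c c).
  by rewrite /lit !mulgA mulVg mul1g expgSr invgM !mulgA.
apply: leq_trans (word_lengthM _ _ _) _.
apply: leq_trans (leq_add (word_lengthM _ _ _) IHj) _.
have := word_length_aX (c j.+1); have := word_length_tXV 1; rewrite expg1.
by rewrite (mulSn j.+1); lia.
Qed.

(** The sweep ends on the side of the final position, upwards when p - m is
    nonnegative and downwards otherwise, so that at most m steps remain. *)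
Lemma word_length_placed c p : p <= m.*2 ->
  wl (placed c p) <= m.*2.+1 * n./2 + 4 * m.
Proof.
move=> pm; have [mp|mp] := leqP m p.
  have -> : placed c p =
      t ^- m * (lamps c m.*2.+1 * t ^+ m.*2 * t ^- (m.*2 - p)).
    rewrite /placed -!mulgA; congr (_ * (_ * _)).
    by rewrite -{1}(subnK pm) addnC expgnDr mulgK.
  apply: leq_trans (word_lengthM _ _ _) _.
  apply: leq_trans (leq_add (word_length_tXV _) (word_lengthM _ _ _)) _.
  have up := leq_add (sweep_up c m.*2) (word_length_tXV (m.*2 - p)).
  apply: leq_trans (leq_add (leqnn _) up) _.
  lia.
have -> : placed c p = t ^+ m * (t ^- m.*2 * lamps c m.*2.+1) * t ^+ p.
  by rewrite /placed -addnn expgnDr invgM !mulgA mulgV mul1g.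
apply: leq_trans (word_lengthM _ _ _) _.
apply: leq_trans (leq_add (word_lengthM _ _ _) (word_length_tX _)) _.
have down := leq_add (word_length_tX m) (sweep_down c m.*2).
apply: leq_trans (leq_add down (leqnn _)) _.
lia.
Qed.

(** * The upper bound is attained *)

Lemma gact_lamps h j f p :
  gact (lamps (fun=> h) j) (f, p) =
    ((fun i => f i + (h%:R : 'I_n) *+ (p <= i < p + j%:Z)%R)%R, p).
Proof.
elim: j => [|j IHj].
  rewrite /lamps big_ord0 gact1; congr (_, _); apply/funext => i.
  by have -> : (p <= i < p + 0)%R = false by [lia]; rewrite addr0.
rewrite /lamps big_ord_recr gactM -/(lamps _ j) IHj /= /lit !gactM.
rewrite gact_tX gact_aX gact_tXV; congr (_, _); last lia.
apply/funext => i; rewrite /toggle -addrA -mulrnDr; congr (_ + _ *+ _)%R.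
case: eqP => ij; first by rewrite ij; lia.
by rewrite addn0; lia.
Qed.

Lemma le_word_length_placed :
  m.*2.+1 * n./2 + 4 * m <= wl (placed (fun=> n./2) m).
Proof.
have [s [<- sX sE]] :=
  is_product_word_length (lamp_generates n) (placed (fun=> n./2) m).
have := toured_prod m sX.
rewrite -sE /placed !gactM gact_tXV gact_lamps gact_tX.
case=> K [M [/= pKM fKM cost]].
have half_n : n./2.*2 <= n by have := odd_double_half n; lia.
have half_neq0 : (n./2%:R : 'I_n)%R != 0%R.
  apply/eqP => h0; have := lamp_cost_nat half_n; rewrite h0 lamp_cost0.
  by have := odd_double_half n; lia.
(* Every lamp of the window is lit at the end, so the walk went to both ends. *)
have lit_in (i : int) : (- m%:Z <= i <= m%:Z)%R -> (- K%:Z <= i <= M%:Z)%R.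
  move=> im; apply: fKM; rewrite add0r.
  have -> : (0 - m%:Z <= i < 0 - m%:Z + m.*2.+1%:Z)%R by lia.
  exact: half_neq0.
have mK : (- K%:Z <= - m%:Z <= M%:Z)%R by apply: lit_in; lia.
have mM : (- K%:Z <= m%:Z <= M%:Z)%R by apply: lit_in; lia.
have costE : window_cost m (fun i => 0 + (n./2%:R : 'I_n) *+
    (0 - m%:Z <= i < 0 - m%:Z + m.*2.+1%:Z)%R)%R = (m.*2.+1 * n./2)%N.
  rewrite /window_cost -[m.*2.+1 in RHS]card_ord -sum_nat_const.
  apply: eq_bigr => i _; have im := ltn_ord i.
  have -> : (0 - m%:Z <= i%:Z - m%:Z < 0 - m%:Z + m.*2.+1%:Z)%R by lia.
  by rewrite add0r lamp_cost_nat.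
move: cost; rewrite costE; move: (m.*2.+1 * n./2)%N => C cost; lia.
Qed.

End Lamplighter.

Theorem theorem4p3 (n : nat) (n_ge2 : (2 <= n)%N) (k : nat) (k_gt0 : (0 < k)%N) :
  exists w : lamplighter n,
    dead_end (lamp_generates n) w /\ depth_at_least (lamp_generates n) k w.
Proof.
case: n n_ge2 => [|[|n']] // _; exists (placed n' k (fun=> n'.+2./2) k).
set w := placed _ _ _ _.
have deep : depth_at_least (lamp_generates n'.+2) k w.
  move=> s /andP[_ sk] sX.
  have [c [p [-> pk]]] := placed_ball (fun=> n'.+2./2) sX sk.
  apply: leq_trans (le_word_length_placed n' k); apply: word_length_placed; lia.
split=> // x xX; have := deep [:: x]; rewrite big_seq1; apply=> //=.
by rewrite xX.
Qed.
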